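(* Let $p,q\ge 0$ be integers, and let $\alpha_1,\dots,\alpha_p$, $\beta_1,\dots,\beta_q$, $c$, $\xi=\max\{p-1,q\}$, $(\lambda,\tau)$, $\mu_n(c)$, $\vec{\mu}(c)=(\mu_0(c),\dots,\mu_\xi(c))^T$ and the $(\xi+1)\times(\xi+1)$ matrix $\mathbf{M}=\mathbf{M}(c)$ be as defined in the context. Let the $(\xi+1)$-vector polynomials $\vec{P}_n(c)$ be defined by $$\vec{P}_0(c)=(1,0,\dots,0)^T$$ and $$\vec{P}_{n+1}=c(\lambda+c\tau)\frac{d\vec{P}_n}{dc}+\left(\mathbf{M}^T-n\tau c\,\mathbf{I}\right)\vec{P}_n,\qquad n=0,1,\dots,$$ where $\mathbf{I}$ is the $(\xi+1)\times(\xi+1)$ identity matrix. Then $$\mu_n(c)=(\lambda+c\tau)^{-n}\,\vec{P}_n(c)\cdot\vec{\mu}(c),\qquad n=0,1,\dots.$$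
   Context: Parameters: $\alpha_1,\dots,\alpha_p\in\mathbb{C}$ and real $\beta_1,\dots,\beta_q>-1$. The complex variable $c$ ranges over: all of $\mathbb{C}$ if $p<q+1$; $|c|<1$ if $p=q+1$; and, if $p>q+1$, it is assumed that one or more of the $\alpha_i$ is a negative integer $-N$ with $N\in\mathbb{N}$ (so that all sums below are finite), and $c\ne 0$. Pochhammer symbol: $(a)_0=1$, $(a)_x=a(a+1)\cdots(a+x-1)$ for $x\in\mathbb{N}$. Moments: for $n=0,1,\dots$, $$\mu_n(c)=\sum_{x=0}^{\infty}x^n\,\frac{(\alpha_1)_x\cdots(\alpha_p)_x}{(\beta_1+1)_x\cdots(\beta_q+1)_x}\,\frac{c^x}{x!},$$ with the convention $0^0=1$. $(\lambda,\tau)=(1,0)$ if $q+1>p$; $(\lambda,\tau)=(1,-1)$ if $q+1=p$; $(\lambda,\tau)=(0,1)$ if $q+1<p$. Coefficients $\sigma_0(c),\dots,\sigma_\xi(c)$ (polynomials in $c$ of degree at most one): they are obtained from the differential equation $\left[\vartheta(\vartheta+\beta_1)\cdots(\vartheta+\beta_q)-c(\vartheta+\alpha_1)\cdots(\vartheta+\alpha_p)\right]\mu_0=0$, $\vartheta=c\frac{d}{dc}$, by solving for the highest power of $\vartheta$. Explicitly, they are defined by the polynomial identity in an indeterminate $T$ $$T(T+\beta_1)\cdots(T+\beta_q)-c(T+\alpha_1)\cdots(T+\alpha_p)=\varepsilon\left[(\lambda+c\tau)T^{\xi+1}-\sum_{k=0}^{\xi}\sigma_k(c)T^k\right],$$ where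 $\varepsilon=1$ if $q+1\ge p$ and $\varepsilon=-1$ if $q+1<p$ (empty products equal $1$). Matrix $\mathbf{M}(c)$, with rows and columns indexed by $0,1,\dots,\xi$: $\mathbf{M}_{\xi,j}=\sigma_j(c)$ for $0\le j\le\xi$; $\mathbf{M}_{i,i+1}=\lambda+c\tau$ for $0\le i\le\xi-1$; all other entries are $0$. The dot denotes the bilinear product $\vec{u}\cdot\vec{v}=\sum_i u_iv_i$ (no complex conjugation). *)

(* Defs.v *)
From HB Require Import structures.
From mathcomp Require Import all_boot all_order all_algebra.
From mathcomp Require Import complex.
From mathcomp Require Import all_classical all_reals all_analysis.

Set Implicit Arguments.
Unset Strict Implicit.
Unset Printing Implicit Defensive.

Import Order.TTheory GRing.Theory Num.Theory.
Import numFieldNormedType.Exports.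

Local Open Scope classical_set_scope.
Local Open Scope ring_scope.

(* Everything is set up over an arbitrary numFieldType, which carries its norm
   topology; it is meant to be used at R[i] with R : realType.  The parameters
   beta are then the images in R[i] of real numbers. *)

Definition pochhammer (C : numFieldType) (a : C) (x : nat) : C :=
  \prod_(k < x) (a + k%:R).

(* A limit in the norm topology of the partial sums. The convention 0 ^ 0 = 1
   is built in [^+]. *)
Definition moment (C : numFieldType) (p q : nat) (alpha : 'I_p -> C)
    (beta : 'I_q -> C) (c : C) (n : nat) : C :=
  limn (series (fun x : nat =>
    x%:R ^+ n
    * (\prod_(i < p) pochhammer (alpha i) x
       / \prod_(j < q) pochhammer (beta j + 1) x)
    * (c ^+ x / x`!%:R) : C)).

(* Truncated predecessor: max {p - 1, q} is q when p = 0. *)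
Definition xi (p q : nat) : nat := maxn p.-1 q.

Definition lambda (C : numFieldType) (p q : nat) : C :=
  if (p <= q.+1)%N then 1 else 0.

Definition tau (C : numFieldType) (p q : nat) : C :=
  if (p < q.+1)%N then 0 else if p == q.+1 then -1 else 1.

Definition eps (C : numFieldType) (p q : nat) : C :=
  if (p <= q.+1)%N then 1 else -1.

(* In {poly C} the indeterminate 'X stands for c. *)
Definition lead (C : numFieldType) (p q : nat) : {poly C} :=
  (lambda C p q)%:P + tau C p q *: 'X.

(* In {poly {poly C}} the outer indeterminate 'X stands for T (that is, for the
   operator c d/dc), and 'X%:P for c:
   T (T + beta_1) ... (T + beta_q) - c (T + alpha_1) ... (T + alpha_p). *)
Definition ode_symbol (C : numFieldType) (p q : nat) (alpha : 'I_p -> C)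
    (beta : 'I_q -> C) : {poly {poly C}} :=
  'X * \prod_(j < q) ('X + (beta j)%:P%:P)
  - 'X%:P * \prod_(i < p) ('X + (alpha i)%:P%:P).

(* Lemma ode_symbol_sigma below is the defining identity of these coefficients;
   it determines them, since eps is 1 or -1. *)
Definition sigma (C : numFieldType) (p q : nat) (alpha : 'I_p -> C)
    (beta : 'I_q -> C) (k : nat) : {poly C} :=
  - (eps C p q *: (ode_symbol alpha beta)`_k).

Lemma ode_symbol_sigma (C : numFieldType) (p q : nat) (alpha : 'I_p -> C)
    (beta : 'I_q -> C) :
  ode_symbol alpha beta =
    (eps C p q)%:P%:P *
    ((lead C p q)%:P * 'X^((xi p q).+1)
     - \sum_(k < (xi p q).+1) (sigma alpha beta k)%:P * 'X^k).
Proof.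
have XDC (a : C) : 'X + a%:P%:P = 'X - (- a%:P)%:P :> {poly {poly C}}.
  by rewrite polyCN opprK.
pose A : {poly {poly C}} := 'X * \prod_(j < q) ('X + (beta j)%:P%:P).
pose B : {poly {poly C}} := \prod_(i < p) ('X + (alpha i)%:P%:P).
have monB : B \is monic by apply: rpred_prod => i _; rewrite XDC monicXsubC.
have szB : size B = p.+1.
  rewrite /B (eq_bigr _ (fun i _ => XDC (alpha i))).
  by rewrite size_prod_XsubC /index_enum -enumT size_enum_ord.
have monA : A \is monic.
  rewrite monicMr ?monicX //.
  by apply: rpred_prod => i _; rewrite XDC monicXsubC.
have szA : size A = q.+2.
  rewrite /A (eq_bigr _ (fun i _ => XDC (beta i))) mulrC size_mulX.
    by rewrite size_prod_XsubC /index_enum -enumT size_enum_ord.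
  by apply: monic_neq0; apply: rpred_prod => i _; rewrite monicXsubC.
have cA : A`_q.+1 = 1 by move/monicP: monA; rewrite /lead_coef szA.
have cB : B`_p = 1 by move/monicP: monB; rewrite /lead_coef szB.
have cE k : (ode_symbol alpha beta)`_k = A`_k - 'X * B`_k.
  by rewrite /ode_symbol coefB coefCM.
have epsK : eps C p q * eps C p q = 1.
  by rewrite /eps; case: ifP; rewrite ?mulr1 ?mulrNN ?mulr1.
apply/polyP => k; rewrite [RHS]coefCM [X in _ * X]coefB coefCM coefXn.
under eq_bigr do rewrite mul_polyC.
rewrite -(poly_def (xi p q).+1 (fun k => sigma alpha beta k)) coef_poly.
case: (ltngtP k (xi p q).+1) => [lt_k|gt_k|->].
- by rewrite mulr0 sub0r opprK mul_polyC scalerA epsK scale1r.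
- rewrite mulr0 subr0 mulr0 cE !nth_default ?mulr0 ?subr0 //.
    by rewrite szB (leq_ltn_trans _ gt_k) //
               (leq_trans (leqSpred p)) // ltnS leq_maxl.
  by rewrite szA; apply: leq_trans gt_k; rewrite !ltnS leq_maxr.
rewrite mulr1 subr0 cE mul_polyC /lead /lambda /tau /eps /xi.
case: (ltngtP p q.+1) => [lt_p|gt_p|eq_p].
- have /maxn_idPr-> : (p.-1 <= q)%N by rewrite (leq_trans (leq_pred _)).
  by rewrite cA (nth_default _ (_ : size B <= _)%N) ?szB //
             scale0r addr0 mulr0 subr0 scale1r.
- have p0 : (0 < p)%N by apply: leq_trans gt_p.
  have /maxn_idPl-> : (q <= p.-1)%N by rewrite -ltnS prednK // ltnW.
  rewrite prednK // cB nth_default ?szA // sub0r mulr1.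
  by rewrite add0r scale1r scaleN1r.
by move: cB; rewrite eq_p /= maxnn cA => ->; rewrite mulr1 scale1r scaleN1r.
Qed.

Definition Mmat (C : numFieldType) (p q : nat) (alpha : 'I_p -> C)
    (beta : 'I_q -> C) : 'M[{poly C}]_((xi p q).+1) :=
  \matrix_(i, j)
    if i == ord_max then sigma alpha beta j
    else if (j : nat) == i.+1 then lead C p q else 0.

Fixpoint Pvec (C : numFieldType) (p q : nat) (alpha : 'I_p -> C)
    (beta : 'I_q -> C) (n : nat) : 'cV[{poly C}]_((xi p q).+1) :=
  if n is m.+1 then
    let P := Pvec alpha beta m in
    ('X * lead C p q) *: map_mx (@deriv C) P
    + ((Mmat alpha beta)^T - ((m%:R * tau C p q) *: 'X)%:M) *m P
  else delta_mx 0 0.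

(* Main.v *)
Require Import Defs.
From HB Require Import structures.
From mathcomp Require Import all_boot all_order all_algebra.
From mathcomp Require Import complex.
From mathcomp Require Import all_classical all_reals all_analysis.
From mathcomp Require Import ring lra.

(** The idea is that the relation is an identity between power series in c with
    polynomial coefficients, so that no function of c has to be differentiated.

    Let w_x be the weight of x, so that mu_n is the sum over x of
    x^n w_x c^x. As a formal power series, mu_n is the coefficient sequence
    x |-> x^n w_x, and c d/dc is the operator theta that multiplies the entry
    of index x by x; it sends mu_n to mu_(n+1). Polynomials in c act on
    sequences by convolution (convp), and theta obeys the Leibniz rule for that
    action (theta_convp).

    Write L = lambda + c tau. The ratio w_(x+1) / w_x is a ratio of values of
    the two factors of the symbol of the differential equation (weightS), and
    this says that the symbol annihilates the sequences (ode_symbol_weight).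
    Solving for the highest power of theta gives L mu_(xi+1) = sum_k sigma_k
    mu_k, the last row of the system L theta mu = M mu; the other rows are
    trivial (lead_moment_seq). Applying theta to L^n mu_n = P_n . mu and then
    multiplying by L yields exactly the recurrence that defines P_(n+1), where
    the term - n tau c P_n comes from the derivative of L^n
    (convp_lead_moment_seq).

    To return to numbers one needs only that each series mu_n converges at c:
    multiplying the coefficient sequence by a polynomial P then multiplies the
    sum by P(c) (cvg_series_convp), because this is true for the shift. The
    convergence is the ratio test. The ratio of the norms of consecutive terms
    is at most a real sequence that tends to |c| if p = q + 1 and to 0 if
    p < q + 1 (norm_term_ratio, cvg_ratio), and the series is a finite sum if
    p > q + 1. Finally L(c) is 1, 1 - c or c in the three cases, hence nonzero,
    and L(c)^n can be divided out. *)

Set Implicit Arguments.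
Unset Strict Implicit.
Unset Printing Implicit Defensive.

Import Order.TTheory GRing.Theory Num.Theory.
Import numFieldNormedType.Exports.

Local Open Scope classical_set_scope.
Local Open Scope ring_scope.

(** * Polynomials acting on coefficient sequences *)

Section FormalSeries.
Variable R : comNzRingType.
Implicit Types (P Q : {poly R}) (f g : nat -> R).

(** A sequence f stands for the power series of coefficients f x, and convp P f
    for its product with P: truncated subtraction is harmless since k <= x. *)
Definition convp P f : nat -> R :=
  fun x => \sum_(k < x.+1) P`_k * f (x - k)%N.

(** The Euler operator c d/dc, read on coefficients. *)
Definition theta f : nat -> R := fun x => x%:R * f x.

(** The coefficient of index x of a product sees only the coefficients of index
    at most x of the factors, so convp can be computed with polynomials; the
    module law convpM is then associativity of the polynomial product. *)
Lemma convp_coef P f N x :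
  (x < N)%N -> convp P f x = (P * \poly_(k < N) f k)`_x.
Proof.
move=> xN; rewrite coefM; apply: eq_bigr => k _.
by rewrite coef_poly (leq_ltn_trans (leq_subr _ _) xN).
Qed.

Lemma convpM P Q f : convp (P * Q) f = convp P (convp Q f).
Proof.
apply/funext => x; rewrite (@convp_coef _ _ x.+1) // -mulrA coefM.
apply: eq_bigr => k _; congr (_ * _).
by rewrite -convp_coef // ltnS leq_subr.
Qed.

Lemma convpC (a : R) f x : convp a%:P f x = a * f x.
Proof.
rewrite /convp big_ord_recl coefC /= subn0 big1 ?addr0 // => k _.
by rewrite coefC /= mul0r.
Qed.

Lemma convpX f x : convp 'X f x = if x is y.+1 then f y else 0.
Proof.
rewrite (@convp_coef _ _ x.+1) // coefXM; case: x => //= y.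
by rewrite coef_poly ltnS leqnSn.
Qed.

Lemma convpDl P Q f : convp (P + Q) f = convp P f + convp Q f.
Proof.
apply/funext => x; rewrite !fctE /convp -big_split /=; apply: eq_bigr => k _.
by rewrite coefD mulrDl.
Qed.

Lemma convpNl P f : convp (- P) f = - convp P f.
Proof.
apply/funext => x; rewrite !fctE /convp -sumrN; apply: eq_bigr => k _.
by rewrite coefN mulNr.
Qed.

Lemma convpDr P f g : convp P (f + g) = convp P f + convp P g.
Proof.
apply/funext => x; rewrite !fctE /convp -big_split /=; apply: eq_bigr => k _.
by rewrite mulrDr.
Qed.

Lemma convp0 f : convp 0 f = 0.
Proof.
by apply/funext => x; rewrite /convp big1 // => k _; rewrite coef0 mul0r.
Qed.

Lemma convp_suml (I : Type) (s : seq I) (F : I -> {poly R}) f :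
  convp (\sum_(i <- s) F i) f = \sum_(i <- s) convp (F i) f.
Proof.
apply: (big_morph (convp^~ f)) => [P Q|]; first exact: convpDl.
by apply/funext => x; rewrite /convp big1 // => k _; rewrite coef0 mul0r.
Qed.

Lemma convp_sumr (I : Type) (s : seq I) P (F : I -> nat -> R) :
  convp P (\sum_(i <- s) F i) = \sum_(i <- s) convp P (F i).
Proof.
apply: (big_morph (convp P)) => [f g|]; first exact: convpDr.
by apply/funext => x; rewrite /convp big1 // => k _; rewrite mulr0.
Qed.

Lemma theta_sum (I : Type) (s : seq I) (F : I -> nat -> R) :
  theta (\sum_(i <- s) F i) = \sum_(i <- s) theta (F i).
Proof.
apply: (big_morph theta) => [f g|]; apply/funext => x.
  by rewrite /theta !fctE mulrDr.
by rewrite /theta mulr0.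
Qed.

(** Leibniz rule for c d/dc: it holds term by term, from x = k + (x - k). *)
Lemma theta_convp P f :
  theta (convp P f) = convp ('X * P^`()) f + convp P (theta f).
Proof.
apply/funext => x; rewrite /theta /convp mulr_sumr fctE -big_split /=.
apply: eq_bigr => k _; have -> : ('X * P^`())`_k = k%:R * P`_k.
  case: (nat_of_ord k) => [|j]; rewrite coefXM ?mul0r //=.
  by rewrite coef_deriv mulr_natl.
by rewrite -{1}(subnKC (ltn_ord k : k <= x)%N) natrD; ring.
Qed.

(** The coefficients of the n-th power of theta applied to the series of
    coefficients a. *)
Definition moment_seq (a : nat -> R) (n : nat) : nat -> R :=
  fun x => x%:R ^+ n * a x.

Lemma theta_moment_seq a n :
  theta (moment_seq a n) = moment_seq a n.+1.
Proof. by apply/funext => x; rewrite /theta /moment_seq mulrA exprS. Qed.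

(** The induction on n, for any first-order system L theta mu = A mu satisfied
    by the vector mu = (mu_0, ..., mu_m) of series, with L of degree at most
    one. *)
Lemma convp_lead_moment_seq (m : nat) (A : 'M[{poly R}]_m.+1)
    (l t : R) (P : nat -> 'cV[{poly R}]_m.+1) (a : nat -> R) :
  let L : {poly R} := l%:P + t *: 'X in
  P 0%N = delta_mx 0 0 ->
  (forall n, P n.+1 = ('X * L) *: map_mx (@deriv R) (P n)
     + (A^T - ((n%:R * t) *: 'X)%:M) *m P n) ->
  (forall i : 'I_m.+1, convp L (moment_seq a i.+1) =
     \sum_(j < m.+1) convp (A i j) (moment_seq a j)) ->
  forall n, convp (L ^+ n) (moment_seq a n) =
    \sum_(i < m.+1) convp (P n i 0) (moment_seq a i).
Proof.
move=> L P0 PS rowA; elim=> [|n IHn].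
  rewrite P0 big_ord_recl big1 => [|i _].
    by rewrite mxE eqxx addr0.
  by rewrite mxE /= mulr0n convp0.
have dL : L^`() = t%:P by rewrite derivD derivC derivZ derivX add0r alg_polyC.
have LdLn : L * ('X * (L ^+ n)^`()) = ((n%:R * t) *: 'X) * L ^+ n.
  case: n {IHn} => [|n].
    by rewrite expr0 derivC !mul0r scale0r mul0r !mulr0.
  rewrite deriv_exp dL exprS -mul_polyC polyCM -[n.+1%:R]/(1 *+ n.+1) polyCMn.
  rewrite -mulr_natl polyC1 [in LHS]/=; ring.
(* The recurrence, entry by entry, with the factor L pulled out in front of the
   derivative as it appears after multiplication by L. *)
have entry j : P n.+1 j 0 = L * ('X * (P n j 0)^`())
    + (\sum_(i < m.+1) P n i 0 * A i j - ((n%:R * t) *: 'X) * P n j 0).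
  rewrite PS mulmxBl mul_scalar_mx !mxE; congr (_ + (_ - _)).
  - by rewrite mulrA (mulrC L).
  - by apply: eq_bigr => i _; rewrite mxE mulrC.
(* The induction hypothesis under theta, then multiplied by L. *)
have step : convp (L * ('X * (L ^+ n)^`())) (moment_seq a n) +
    convp (L ^+ n.+1) (moment_seq a n.+1) =
    \sum_(i < m.+1) (convp (L * ('X * (P n i 0)^`())) (moment_seq a i)
      + convp (P n i 0) (convp L (moment_seq a i.+1))).
  rewrite exprS !convpM -convpDr -theta_moment_seq -convpM -theta_convp IHn.
  rewrite theta_sum convp_sumr; apply: eq_bigr => i _.
  rewrite theta_convp convpDr theta_moment_seq; congr (_ + _).
    by rewrite -convpM.
  by rewrite -!convpM mulrC.
apply: (addrI (convp (L * ('X * (L ^+ n)^`())) (moment_seq a n))).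
rewrite step LdLn convpM IHn convp_sumr -big_split /=.
under eq_bigr => i _ do rewrite rowA convp_sumr.
rewrite big_split exchange_big -big_split /=; apply: eq_bigr => j _.
rewrite entry !convpDl convpNl -convpM addrCA; congr (_ + _).
rewrite addrC subrK convp_suml; apply: eq_bigr => i _.
by rewrite convpM.
Qed.

End FormalSeries.

(** * The weights and the differential equation *)

Section Hypergeometric.
Variables (C : numFieldType) (p q : nat) (alpha : 'I_p -> C) (beta : 'I_q -> C).
Hypothesis beta_nonres : forall j x, beta j + x.+1%:R != 0.

Definition weight (x : nat) : C :=
  \prod_(i < p) pochhammer (alpha i) x
       / \prod_(j < q) pochhammer (beta j + 1) x / x`!%:R.

Let A : {poly C} := 'X * \prod_(j < q) ('X + (beta j)%:P).
Let B : {poly C} := \prod_(i < p) ('X + (alpha i)%:P).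

(** Passing from x to x + 1 multiplies the weight by the factors alpha_i + x,
    which are those of B, and divides it by x + 1 and the beta_j + x + 1, which
    are those of A and do not vanish. *)
Lemma weightS x :
  A.[x.+1%:R] * weight x.+1 = B.[x%:R] * weight x.
Proof.
rewrite /A /B hornerM hornerX !horner_prod.
under eq_bigr do rewrite hornerD hornerX hornerC addrC.
under [X in _ = X * _]eq_bigr do rewrite hornerD hornerX hornerC addrC.
rewrite /weight.
have -> : \prod_(i < p) pochhammer (alpha i) x.+1 =
    \prod_(i < p) pochhammer (alpha i) x * \prod_(i < p) (alpha i + x%:R).
  rewrite -big_split; apply: eq_bigr => i _.
  by rewrite /pochhammer big_ord_recr.
have -> : \prod_(j < q) pochhammer (beta j + 1) x.+1 =
    \prod_(j < q) pochhammer (beta j + 1) x * \prod_(j < q) (beta j + x.+1%:R).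
  rewrite -big_split; apply: eq_bigr => j _.
  rewrite /pochhammer big_ord_recr /=.
  by rewrite -addrA nat1r.
have nz1 : \prod_(j < q) (beta j + x.+1%:R) != 0.
  by apply/prodf_neq0 => j _.
have nz2 : \prod_(j < q) pochhammer (beta j + 1) x != 0.
  apply/prodf_neq0 => j _; apply/prodf_neq0 => k _.
  by rewrite -addrA nat1r.
have nz3 : x`!%:R != 0 :> C by rewrite pnatr_eq0 -lt0n fact_gt0.
have nz4 : x.+1%:R != 0 :> C by rewrite pnatr_eq0.
rewrite factS natrM.
move: (x.+1%:R) nz1 nz4 => y nz1 nz4.
by field; rewrite nz1 nz2 nz3 nz4.
Qed.

Lemma coef_ode_symbol k :
  (ode_symbol alpha beta)`_k = (A`_k)%:P - 'X * (B`_k)%:P.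
Proof.
have -> : ode_symbol alpha beta = map_poly polyC A - 'X%:P * map_poly polyC B.
  rewrite /A /B rmorphM /= map_polyX !rmorph_prod; congr (_ * _ - _ * _).
    by apply: eq_bigr => j _; rewrite rmorphD /= map_polyX map_polyC.
  by apply: eq_bigr => j _; rewrite rmorphD /= map_polyX map_polyC.
by rewrite coefB coefCM !coef_map.
Qed.

Lemma size_prod_XaddC n (u : 'I_n -> C) :
  size (\prod_(i < n) ('X + (u i)%:P)) = n.+1.
Proof.
under eq_bigr do rewrite -[u _]opprK polyCN.
by rewrite size_prod_XsubC /index_enum -enumT size_enum_ord.
Qed.

(** The differential equation for mu_0. The coefficient of c^x on the left is
    A(x) w_x - B(x - 1) w_(x-1), which is zero by weightS, and for x = 0
    because T divides A. *)
Lemma ode_symbol_weight :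
  \sum_(k < (xi p q).+2)
     convp (ode_symbol alpha beta)`_k (moment_seq weight k) = 0.
Proof.
have szA : (size A <= (xi p q).+2)%N.
  rewrite (leq_trans (size_mul_leq _ _)) // size_polyX size_prod_XaddC.
  by rewrite !ltnS leq_maxr.
have szB : (size B <= (xi p q).+2)%N.
  by rewrite size_prod_XaddC ltnS (leq_trans (leqSpred p)) // ltnS leq_maxl.
apply/funext => x; rewrite fct_sumE.
under eq_bigr => k _.
  rewrite coef_ode_symbol convpDl convpNl convpM !fctE convpC convpX.
  over.
rewrite sumrB /=.
under eq_bigr => k _ do rewrite /moment_seq mulrA.
rewrite -mulr_suml -(horner_coef_wide _ szA).
case: x => [|x].
  by rewrite big1 // subr0 /A hornerM hornerX !mul0r.
under eq_bigr => k _ do rewrite convpC /moment_seq mulrA.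
by rewrite -mulr_suml -(horner_coef_wide _ szB) weightS subrr.
Qed.

(** Row i of L theta mu = M mu. The last row is the differential equation solved
    for the highest power of theta; each other row has the single entry L. *)
Lemma lead_moment_seq (i : 'I_(xi p q).+1) :
  convp (lead C p q) (moment_seq weight i.+1) =
  \sum_(j < (xi p q).+1) convp (Mmat alpha beta i j) (moment_seq weight j).
Proof.
have [->|ne_i] := eqVneq i ord_max; last first.
  have lti : (i.+1 < (xi p q).+1)%N.
    by rewrite ltn_neqAle ltn_ord andbT -[_.+1]/(nat_of_ord ord_max).+1.
  rewrite (bigD1 (Ordinal lti)) //= big1 => [|j ne_j].
    by rewrite addr0 mxE (negPf ne_i) /= eqxx.
  rewrite mxE (negPf ne_i) -[_ == _.+1]/(j == Ordinal lti) (negPf ne_j).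
  exact: convp0.
have epsK : eps C p q * eps C p q = 1.
  by rewrite /eps; case: ifP; rewrite ?mulr1 ?mulrNN ?mulr1.
(* Up to the sign eps, which is its own inverse, the leading coefficient in T of
   the symbol is L. *)
have leadE : lead C p q = (eps C p q)%:P * (ode_symbol alpha beta)`_(xi p q).+1.
  rewrite ode_symbol_sigma coefCM coefB coefCM coefXn eqxx mulr1.
  under eq_bigr do rewrite mul_polyC.
  rewrite -(poly_def (xi p q).+1 (sigma alpha beta)) coef_poly ltnn subr0 mulrA.
  by rewrite -polyCM epsK mul1r.
have := congr1 (convp (eps C p q)%:P) ode_symbol_weight.
rewrite convp_sumr big_ord_recr /=.
rewrite -convpM -leadE => /eqP; rewrite addrC.
have -> : convp (eps C p q)%:P 0 = 0.
  by apply/funext => x; rewrite convpC mulr0.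
rewrite addr_eq0 => /eqP ->; rewrite -sumrN; apply: eq_bigr => j _.
by rewrite mxE eqxx /sigma -mul_polyC convpNl convpM.
Qed.

Lemma formal_moments n :
  convp (lead C p q ^+ n) (moment_seq weight n) =
  \sum_(i < (xi p q).+1) convp (Pvec alpha beta n i 0) (moment_seq weight i).
Proof.
exact: (@convp_lead_moment_seq _ _ (Mmat alpha beta) _ _
          (Pvec alpha beta) weight erefl (fun=> erefl) lead_moment_seq).
Qed.

End Hypergeometric.

(** * Evaluation of the formal identity *)

(** Horner induction on P reduces this to the shift of a sequence, which
    multiplies the sum of the series by c. *)
Lemma cvg_series_convp (C : numFieldType) (c : C) (P : {poly C}) (f : nat -> C)
    (s : C) :
  series (fun x => f x * c ^+ x) @ \oo --> s ->
  series (fun x => convp P f x * c ^+ x) @ \oo --> P.[c] * s.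
Proof.
move=> fs; elim/poly_ind: P => [|P a IHP].
  rewrite horner0 mul0r convp0.
  rewrite (_ : series _ = fun=> 0); first exact: cvg_cst.
  by apply/funext => m; rewrite /series /= big1 // => k _; rewrite mul0r.
rewrite hornerMXaddC mulrDl mulrAC -cvg_shiftS.
rewrite (_ : (fun n => _) = (fun m =>
    series (fun x => convp P f x * c ^+ x) m * c
    + a * series (fun x => f x * c ^+ x) m.+1)).
  apply: cvgD; first by apply: cvgMl.
  by apply: cvgMr; rewrite cvg_shiftS.
apply/funext => m; rewrite /series /= mulr_sumr mulr_suml.
under eq_bigr => x _ do
  rewrite convpDl [P * _]mulrC convpM fctE convpX convpC mulrDl -mulrA.
rewrite big_split big_nat_recl //= mul0r add0r; congr (_ + _).
by apply: eq_bigr => x _; rewrite exprSr mulrA.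
Qed.

Lemma hausdorff_numField (C : numFieldType) : hausdorff_space C.
Proof. exact: (@norm_hausdorff C C). Qed.

Lemma momentE (C : numFieldType) (p q : nat) (alpha : 'I_p -> C)
    (beta : 'I_q -> C) c n :
  moment alpha beta c n =
  limn (series (fun x => moment_seq (weight alpha beta) n x * c ^+ x)).
Proof.
rewrite /moment; congr (limn (series _)); apply/funext => x.
by rewrite /moment_seq /weight -!mulrA [x`!%:R^-1 * _]mulrC.
Qed.

(** The formal identity summed at c: convolution by a polynomial becomes
    multiplication by its value at c. *)
Lemma lead_moment (C : numFieldType) (p q : nat) (alpha : 'I_p -> C)
    (beta : 'I_q -> C) (c : C) :
  (forall j x, beta j + x.+1%:R != 0) ->
  (forall n, cvgn (series (fun x =>
     moment_seq (weight alpha beta) n x * c ^+ x))) ->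
  forall n, (lead C p q).[c] ^+ n * moment alpha beta c n =
  \sum_(i < (xi p q).+1) (Pvec alpha beta n i 0).[c] * moment alpha beta c i.
Proof.
move=> nres cvgM n; rewrite momentE -horner_exp.
under eq_bigr do rewrite momentE.
have /(cvg_lim (@hausdorff_numField C)) <- :=
  cvg_series_convp (P := lead C p q ^+ n) (cvgM n).
rewrite (formal_moments _ nres).
apply: (cvg_lim (@hausdorff_numField C)).
have cvgP i := cvg_series_convp (P := Pvec alpha beta n i 0) (cvgM i).
have -> : series (fun x => (\sum_(i < (xi p q).+1) convp (Pvec alpha beta n i 0)
    (moment_seq (weight alpha beta) i)) x * c ^+ x) =
  (fun m => \sum_(i < (xi p q).+1)
    series (fun x => convp (Pvec alpha beta n i 0)
      (moment_seq (weight alpha beta) i) x * c ^+ x) m).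
  apply/funext => m; rewrite /series /= exchange_big; apply: eq_bigr => x _.
  by rewrite fct_sumE mulr_suml.
by apply: cvg_big => [|i _]; [exact: add_continuous|exact: cvgP].
Qed.

(** * The ratio test for complex series *)

(** Convergence for the topology carried by an arbitrary numFieldType. Stated
    over an abstract field so that it can be applied to R[i], on which this
    topology is not found by unification. *)
Lemma cvgn_numField (C : numFieldType) (u : nat -> C) (l : C) :
  (forall e, 0 < e -> \forall m \near \oo, `|l - u m| < e) -> cvgn u.
Proof. by move=> ul; apply/cvg_ex; exists l; apply/cvgrPdist_lt. Qed.

Section Ratio.
Variable R : realType.

Lemma ratio_test (s : nat -> R) (r : R) (N : nat) :
  0 < r < 1 -> (forall x, 0 <= s x) ->
  (forall x, (N <= x)%N -> s x.+1 <= r * s x) -> cvgn (series s).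
Proof.
move=> /andP[r0 r1] s0 ratio.
(* K r^x dominates s x at each of the indices x <= N, since s x / r^x is one of
   the summands of K; from N on the ratio bound propagates it. *)
pose K := \sum_(k < N.+1) s k / r ^+ k.
have K0 : 0 <= K.
  by apply: sumr_ge0 => k _; rewrite divr_ge0 // exprn_ge0 // ltW.
have early x : (x <= N)%N -> s x <= K * r ^+ x.
  move=> xN; rewrite -ler_pdivrMr ?exprn_gt0 //.
  rewrite /K (bigD1 (Ordinal (xN : x < N.+1)%N)) //= lerDl.
  by apply: sumr_ge0 => k _; rewrite divr_ge0 // exprn_ge0 // ltW.
have bound x : s x <= K * r ^+ x.
  have [/early//|/ltnW /subnK <-] := leqP x N.
  elim: (x - N)%N => [|k IHk]; first exact: early.
  rewrite addSn (le_trans (ratio _ (leq_addl _ _))) // exprS mulrCA.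
  by rewrite ler_pM2l.
apply: (series_le_cvg s0 _ bound).
  by move=> x; rewrite mulr_ge0 // exprn_ge0 // ltW.
by apply: (@is_cvg_geometric_series _ K r); rewrite ger0_norm // ltW.
Qed.

Local Open Scope complex_scope.

Lemma norm_real_complex (x : R) : `|x%:C| = `|x|%:C.
Proof. by rewrite normc_def /= expr0n addr0 sqrtr_sqr. Qed.

Lemma norm_complex_i : `|'i| = 1 :> R[i].
Proof. by rewrite normc_def /= expr0n expr1n add0r sqrtr1. Qed.

Lemma normc_le_ReIm (z : R[i]) : `|z| <= (`|complex.Re z| + `|complex.Im z|)%:C.
Proof.
rewrite {1}[z]complexE (le_trans (ler_normD _ _)) // normrM.
rewrite rmorphD /= !norm_real_complex.
by rewrite norm_complex_i mul1r.
Qed.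

(** Absolute convergence implies convergence in R[i], through the real and
    imaginary parts. The norm of R[i] takes values in R[i], hence the projection
    to R. *)
Lemma cvg_series_complex (u : nat -> (R[i] : numFieldType)) :
  cvgn (series (fun x => complex.Re `|u x|)) -> cvgn (series u).
Proof.
move=> cu.
have partE x : (complex.Re `|u x|)%:C = `|u x| by rewrite RRe_real ?normr_real.
have cvg_part (h : R[i] -> R) : (forall z, `|h z|%:C <= `|z|) ->
    cvgn (series (h \o u)).
  move=> hle; apply: normed_cvg; apply: series_le_cvg cu => //= x.
    by rewrite -ler0c partE.
  by rewrite -lecR partE hle.
have /cvg_ex[/= a cva] := cvg_part _ (@normc_ge_Re _).
have /cvg_ex[/= b cvb] : cvgn (series (@complex.Im R \o u)).
  apply: cvg_part => z; rewrite (le_trans _ (_ : `|z * 'i| <= _)) //.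
    by rewrite -normrN -ReiNIm normc_ge_Re.
  by rewrite normrM norm_complex_i mulr1.
have sumE m : series u m =
    series (@complex.Re R \o u) m +i* series (@complex.Im R \o u) m.
  rewrite /series /=; elim: m => [|m IHm]; first by rewrite !big_geq.
  by rewrite !big_nat_recr //= IHm; case: (u m).
apply: (@cvgn_numField _ _ (a +i* b)) => -[e e'] /=.
rewrite ltcE /= => /andP[/eqP -> e0].
have e2 : 0 < e / 2 by rewrite divr_gt0.
near=> m.
have -> : a +i* b - series u m =
   (a - series (@complex.Re R \o u) m) +i* (b - series (@complex.Im R \o u) m).
  by rewrite sumE.
rewrite (le_lt_trans (normc_le_ReIm _)) //= ltcR [ltRHS]splitr ltrD //.
- by near: m; move/cvgrPdist_lt: cva; exact.
- by near: m; move/cvgrPdist_lt: cvb; exact.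
Unshelve. all: by end_near. Qed.

End Ratio.

(** * Convergence of the moment series *)

(** The ratio of consecutive weights is known from weightS; the only estimate is
    |alpha_i + x| <= |alpha_i| + x. *)
Lemma norm_term_ratio (C : numFieldType) (p q : nat) (alpha : 'I_p -> C)
    (beta : 'I_q -> C) (c : C) (n x : nat) :
  (forall j y, 0 < beta j + y.+1%:R) -> (0 < x)%N ->
  let u := fun y => moment_seq (weight alpha beta) n y * c ^+ y in
  `|u x.+1| <= (x.+1%:R / x%:R) ^+ n
     * (\prod_(i < p) (`|alpha i| + x%:R)
        / (x.+1%:R * \prod_(j < q) (beta j + x.+1%:R)))
     * `|c| * `|u x|.
Proof.
move=> beta0 x0 /=.
have nres j y : beta j + y.+1%:R != 0 by rewrite gt_eqF.
have x'0 : 0 < x%:R :> C by rewrite ltr0n.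
have D0 : 0 < x.+1%:R * \prod_(j < q) (beta j + x.+1%:R).
  by rewrite mulr_gt0 ?ltr0n // prodr_gt0.
have := weightS alpha nres x.
rewrite !hornerM !horner_prod hornerX.
under eq_bigr do rewrite hornerD hornerX hornerC addrC.
under [X in _ = X * _]eq_bigr do rewrite hornerD hornerX hornerC addrC.
move=> /(congr1 Num.norm); rewrite [LHS]normrM [RHS]normrM (gtr0_norm D0).
set D := _ * \prod_(j < q) _ in D0 *.
rewrite /moment_seq; move: (weight alpha beta) => w wE.
rewrite !normrM !normrX !normr_nat.
have -> : `|w x.+1| =
    D^-1 * (`|\prod_(i < p) (alpha i + x%:R)| * `|w x|).
  by rewrite -wE mulKf // gt_eqF.
rewrite exprS expr_div_n.
set W := `|w x|; set B := \prod_(i < p) (`|alpha i| + _).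
set Z := `|c|; set E := x.+1%:R ^+ n; set F := x%:R ^+ n.
have F0 : F != 0 by rewrite expf_neq0 // gt_eqF.
have DN : D != 0 by rewrite gt_eqF.
rewrite [leRHS](_ : _ = (E * D^-1 * W * (Z * Z ^+ x)) * B); last first.
  by field; rewrite F0 DN.
rewrite [leLHS](_ : _ = (E * D^-1 * W * (Z * Z ^+ x))
    * `|\prod_(i < p) (alpha i + x%:R)|); last first.
  by field; rewrite DN.
apply: ler_wpM2l.
  by rewrite !mulr_ge0 ?exprn_ge0 ?invr_ge0 ?normr_ge0 ?ler0n // ltW.
rewrite normr_prod; apply: ler_prod => i _; rewrite normr_ge0 /=.
by rewrite (le_trans (ler_normD _ _)) // normr_nat.
Qed.

(** With h = 1 / (x + 1), each factor a_i + x is (x + 1) (1 + (a_i - 1) h) and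
    each beta_j + x + 1 is (x + 1) (1 + beta_j h), so what remains besides
    factors that tend to 1 is h^(q + 1 - p) g. *)
Lemma cvg_ratio (R : realType) (p q : nat) (a : 'I_p -> R) (beta : 'I_q -> R)
    (g : R) (n : nat) :
  (p <= q.+1)%N ->
  (fun x => (x.+1%:R / x%:R) ^+ n
     * (\prod_(i < p) (a i + x%:R)
        / (x.+1%:R * \prod_(j < q) (beta j + x.+1%:R)))
     * g) @ \oo --> (if p == q.+1 then g else 0).
Proof.
move=> le_p.
pose h : nat -> R := fun x => x.+1%:R^-1.
have h0 : h @ \oo --> (0 : R) by exact: cvg_harmonic.
have hK x : x.+1%:R * h x = 1 by rewrite divff // pnatr_eq0.
have lin (b : R) : (fun x => 1 + b * h x) @ \oo --> (1 : R).
  rewrite -[X in _ --> X]addr0; apply: cvgD; first exact: cvg_cst.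
  by rewrite -[X in _ --> X](mulr0 b); apply: cvgMr.
have prod1 (I : finType) (F : I -> nat -> R) :
    (forall i, F i @ \oo --> (1 : R)) ->
    (fun x => \prod_i F i x) @ \oo --> (1 : R).
  move=> F1; have e : \prod_(i : I) 1 = 1 :> R by rewrite big1.
  rewrite -[X in _ --> X]e.
  by apply: cvg_big => [|i _]; [exact: mul_continuous | exact: F1].
have powc (F : nat -> R) (l : R) k :
    F @ \oo --> l -> (fun x => F x ^+ k) @ \oo --> l ^+ k.
  move=> Fl; elim: k => [|k IHk]; first exact: cvg_cst.
  by rewrite exprS; under eq_fun do rewrite exprS; apply: cvgM.
(* At x = 0 both (x + 1) / x and 1 / (1 - h) are inverses of 0, hence 0, so the
   rewriting is valid for every x. *)
rewrite (_ : (fun x => _) = (fun x => (1 + -1 * h x)^-1 ^+ n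
   * \prod_(i < p) (1 + (a i - 1) * h x)
   * (\prod_(j < q) (1 + beta j * h x))^-1 * (h x ^+ (q.+1 - p) * g))).
  rewrite -[X in _ --> X]mul1r; apply: cvgM.
    rewrite -[X in _ --> X](mulr1 1); apply: cvgM.
      rewrite -[X in _ --> X](mulr1 1); apply: cvgM.
        rewrite -[X in _ --> X](expr1n _ n).
        apply: (powc (fun x => (1 + -1 * h x)^-1)).
        by rewrite -[X in _ --> X]invr1; apply: cvgV.
      by apply: prod1.
    rewrite -[X in _ --> X]invr1; apply: cvgV => //.
    by apply: prod1.
  case: eqP => [->|/eqP ne_p].
    rewrite subnn; under eq_fun do rewrite expr0 mul1r.
    exact: cvg_cst.
  have [k ->] : exists k, (q.+1 - p)%N = k.+1.
    by exists (q.+1 - p).-1; rewrite prednK // subn_gt0 ltn_neqAle ne_p.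
  rewrite -[X in _ --> X](mul0r g); apply: cvgMl.
  by have := powc h 0 k.+1 h0; rewrite expr0n.
apply/funext => x.
have y0 : x.+1%:R != 0 :> R by rewrite pnatr_eq0.
set y := x.+1%:R in y0 hK *.
have hE : h x = y^-1 by [].
have -> : \prod_(i < p) (a i + x%:R) =
    y ^+ p * \prod_(i < p) (1 + (a i - 1) * h x).
  rewrite -[X in y ^+ X](card_ord p) -prodr_const -big_split /=.
  apply: eq_bigr => i _.
  rewrite hE mulrDr mulr1 mulrCA mulfV // mulr1 /y -natr1; ring.
have -> : \prod_(j < q) (beta j + y) =
    y ^+ q * \prod_(j < q) (1 + beta j * h x).
  rewrite -[X in y ^+ X](card_ord q) -prodr_const -big_split /=.
  apply: eq_bigr => i _.
  by rewrite hE mulrDr mulr1 mulrCA mulfV // mulr1 addrC.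
have -> : y / x%:R = (1 + -1 * h x)^-1.
  rewrite -[LHS]invrK invf_div; congr (_^-1).
  rewrite hE -[x%:R](addrK 1) natr1 -/y mulrBl divff // mul1r mulN1r //.
rewrite [y * (y ^+ q * _)]mulrA -exprS invfM -exprVn -hE -{1}(subnK le_p) exprD.
have hyp : h x ^+ p * y ^+ p = 1.
  by rewrite -exprMn mulrC hK expr1n.
rewrite -[RHS]mul1r -[X in _ = X * _]hyp.
move: (h x ^+ p) (h x ^+ (q.+1 - p)) (y ^+ p) => H1 H2 Y.
move: (_ ^-1 ^+ n) (\prod_(i < p) _) (\prod_(j < q) _)^-1 => V PA PB.
by ring.
Qed.

Local Open Scope complex_scope.

(** If p > q + 1, some alpha_i is - N and its Pochhammer symbol vanishes from
    index N + 1 on; otherwise the ratio of consecutive terms has a limit l < 1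
    and is eventually at most (1 + l) / 2. *)
Lemma cvg_moment_series (R : realType) (p q : nat)
    (alpha : 'I_p -> R[i]) (beta : 'I_q -> R) (c : R[i]) :
  (forall j, -1 < beta j) ->
  (p = q.+1 -> `|c| < 1) ->
  ((q.+1 < p)%N -> exists (i : 'I_p) (N : nat), alpha i = - N%:R) ->
  forall n, cvgn (series (fun x =>
    (moment_seq (weight alpha (fun j => (beta j)%:C)) n x * c ^+ x
      : (R[i] : numFieldType)))).
Proof.
move=> beta1 c1 alphaN n; set u := (X in series X); apply: cvg_series_complex.
have partE z : (complex.Re `|z|)%:C = `|z| :> R[i].
  by rewrite RRe_real ?normr_real.
have part0 z : 0 <= complex.Re (`|z| : R[i]) by rewrite -ler0c partE.
case: (leqP p q.+1) => [le_p|/alphaN[i [N aN]]]; last first.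
  apply: (@ratio_test _ _ 2^-1 N) => [|x|x le_x].
  - by rewrite invr_gt0 ltr0n /= invf_lt1 ?ltr1n.
  - exact: part0.
  have -> : u x.+1 = 0.
    rewrite /u /moment_seq /weight (bigD1 i) //= {1}/pochhammer.
    rewrite (bigD1 (Ordinal (le_x : N < x.+1)%N)) //= aN addNr.
    by rewrite !(mul0r, mulr0).
  by rewrite normr0 mulr_ge0 ?part0 ?invr_ge0.
pose rho x := (x.+1%:R / x%:R) ^+ n
     * (\prod_(i < p) (complex.Re `|alpha i| + x%:R)
        / (x.+1%:R * \prod_(j < q) (beta j + x.+1%:R)))
     * complex.Re `|c|.
pose l := if p == q.+1 then complex.Re `|c| else 0.
have l1 : l < 1.
  by rewrite /l; case: eqP => [/c1|//]; rewrite -ltcR partE.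
have l0 : 0 <= l by rewrite /l; case: eqP.
have /cvgrPdist_lt /(_ ((1 - l) / 2)) : rho @ \oo --> l by exact: cvg_ratio.
case; first by rewrite divr_gt0 // subr_gt0.
move=> N _ rhoN; apply: (@ratio_test _ _ ((1 + l) / 2) N.+1) => [|x|x le_x].
- by apply/andP; split; lra.
- exact: part0.
have rho_le : rho x <= (1 + l) / 2.
  have := rhoN x (ltnW le_x); rewrite /= distrC => /ltr_normlP[_]; lra.
apply: (@le_trans _ _ (rho x * complex.Re `|u x|)); last by rewrite ler_wpM2r.
have cD a b : (a + b)%:C = a%:C + b%:C :> R[i] by exact: rmorphD.
have cM a b : (a * b)%:C = a%:C * b%:C :> R[i] by exact: rmorphM.
have cX a k : (a ^+ k)%:C = a%:C ^+ k :> R[i] by exact: rmorphXn.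
have cV a : (a^-1)%:C = a%:C^-1 :> R[i] by exact: fmorphV.
have cN k : (k%:R)%:C = k%:R :> R[i] by exact: rmorph_nat.
have cprod (I : finType) (F : I -> R) :
    (\prod_i F i)%:C = \prod_i (F i)%:C :> R[i] by exact: rmorph_prod.
rewrite -lecR cM !partE.
have beta0 j y : 0 < (beta j)%:C + y.+1%:R :> R[i].
  rewrite -cN -cD ltcR.
  have := beta1 j; have : 1 <= y.+1%:R :> R by rewrite ler1n. 
  lra.
have := norm_term_ratio alpha c n beta0 (leq_trans (ltn0Sn N) le_x).
rewrite -/u => /le_trans; apply; rewrite le_eqVlt; apply/orP; left; apply/eqP.
rewrite /rho !(cM, cX, cV, cprod, cN) !partE.
congr (_ * (_ / (_ * _)) * _ * _); apply: eq_bigr => k _.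
  by rewrite cD partE cN.
by rewrite cD cN.
Qed.

(** * The moment formula *)

Theorem proposition1 (R : realType) (p q : nat)
    (alpha : 'I_p -> R[i]) (beta : 'I_q -> R) (c : R[i])
    (hbeta : forall j, -1 < beta j)
    (hc_eq : p = q.+1 -> `|c| < 1)
    (hc_gt : (q.+1 < p)%N ->
       (exists (i : 'I_p) (N : nat), (0 < N)%N /\ alpha i = - N%:R)
       /\ c != 0)
    (n : nat) :
  let b : 'I_q -> R[i] := fun j => (beta j)%:C in
  moment alpha b c n =
    (lambda R[i] p q + c * tau R[i] p q) ^- n
    * \sum_(i < (xi p q).+1) (Pvec alpha b n i 0).[c] * moment alpha b c i.
Proof.
move=> b.
have nres j x : b j + x.+1%:R != 0.
  rewrite -[x.+1%:R](rmorph_nat (real_complex R)) -rmorphD /= fmorph_eq0.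
  rewrite gt_eqF //.
  by have := hbeta j; have : 1 <= x.+1%:R :> R by [rewrite ler1n]; lra.
have leadE : (lead R[i] p q).[c] = lambda R[i] p q + c * tau R[i] p q.
  by rewrite /lead hornerD hornerC hornerZ hornerX mulrC.
rewrite -(lead_moment nres).
  rewrite leadE mulKf // expf_neq0 //.
  rewrite /lambda /tau; case: ltngtP => [lt_p|gt_p|eq_p].
  - by rewrite mulr0 addr0 oner_eq0.
  - by rewrite mulr1 add0r; case: (hc_gt gt_p).
  - rewrite mulrN1 subr_eq0; apply: contraTneq (hc_eq eq_p) => <-.
    by rewrite normr1 ltxx.
apply: cvg_moment_series => // /hc_gt[[i [N [_ aN]]] _].
by exists i, N.
Qed.
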